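(* For any two mm-spaces $X$ and $Y$, $$\rho(\mathcal{P}_X,\mathcal{P}_Y)\le d_{\rm conc}(X,Y),$$ i.e. the map $\iota:\mathcal{X}\ni X\mapsto\mathcal{P}_X\in\Pi$ is $1$-Lipschitz continuous with respect to $d_{\rm conc}$ and $\rho$.
   Context: An mm-space is a triple $(X,d_X,\mu_X)$ where $(X,d_X)$ is a complete separable metric space and $\mu_X$ is a Borel probability measure on $X$; it is always assumed that $X=\operatorname{supp}\mu_X$ (otherwise $X$ is replaced by $\operatorname{supp}\mu_X$). Two mm-spaces $X,Y$ are mm-isomorphic if there is an isometry $f:\operatorname{supp}\mu_X\to\operatorname{supp}\mu_Y$ with $f_*\mu_X=\mu_Y$. $\mathcal{X}$ denotes the set of mm-isomorphism classes of mm-spaces. Write $Y\prec X$ if there is a $1$-Lipschitz map $f:X\to Y$ with $f_*\mu_X=\mu_Y$. Let $I=[0,1)$ with Lebesgue measure $\mathcal{L}^1$. A parameter of $X$ is a Borel map $\varphi:I\to X$ with $\varphi_*\mathcal{L}^1=\mu_X$. The box distance $\square(X,Y)$ is the infimum of $\varepsilon\ge 0$ such that there are parameters $\varphi$ of $X$, $\psi$ of $Y$ and a Borel set $I_0\subset I$ with $\mathcal{L}^1(I_0)\ge 1-\varepsilon$ and $|d_X(\varphi(s),\varphi(t))-d_Y(\psi(s),\psi(t))|\le\varepsilon$ for all $s,t\in I_0$. For measurable $f,g:I\to\mathbb{R}$, $\operatorname{me}_{\mathcal{L}^1}(f,g)$ is the infimum of $\varepsilon\ge0$ with $\mathcal{L}^1(\{s\mid|f(s)-g(s)|>\varepsilon\})\le\varepsilon$.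 Let $\mathrm{Lip}_1(X)$ be the set of $1$-Lipschitz functions $X\to\mathbb{R}$ and $\varphi^*\mathrm{Lip}_1(X)=\{f\circ\varphi\mid f\in\mathrm{Lip}_1(X)\}$. The observable distance is $d_{\rm conc}(X,Y):=\inf_{\varphi,\psi}d_H(\varphi^*\mathrm{Lip}_1(X),\psi^*\mathrm{Lip}_1(Y))$, where $\varphi,\psi$ run over all parameters of $X$ and $Y$, and $d_H$ is the Hausdorff distance with respect to $\operatorname{me}_{\mathcal{L}^1}$. A subset $\mathcal{P}\subset\mathcal{X}$ is a pyramid if (i) $X\in\mathcal{P}$ and $Y\prec X$ imply $Y\in\mathcal{P}$; (ii) for any $X,X'\in\mathcal{P}$ there is $Y\in\mathcal{P}$ with $X\prec Y$ and $X'\prec Y$; (iii) $\mathcal{P}$ is nonempty and $\square$-closed. $\Pi$ is the set of pyramids, and $\mathcal{P}_X:=\{X'\in\mathcal{X}\mid X'\prec X\}$. For a natural number $N$ and real $R\ge0$, let $B^N_R=\{x\in\mathbb{R}^N\mid\|x\|_\infty\le R\}$ and let $\mathcal{X}(N,R)\subset\mathcal{X}$ be the set of (classes of) mm-spaces $(B^N_R,\|\cdot\|_\infty,\mu)$ with $\mu$ a Borel probability measure on $B^N_R$. For pyramids $\mathcal{P},\mathcal{P}'$ and natural numbers $k\ge1$ put $$\rho_k(\mathcal{P},\mathcal{P}'):=\frac1{4k}d_H(\mathcal{P}\cap\mathcal{X}(k,k),\mathcal{P}'\cap\mathcal{X}(k,k)),\qquad\rho(\mathcal{P},\mathcal{P}'):=\sum_{k=1}^\infty2^{-k}\rho_k(\mathcal{P},\mathcal{P}'),$$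 where $d_H$ is the Hausdorff distance with respect to $\square$. *)

(* Defs.v *)
From HB Require Import structures.
From mathcomp Require Import all_boot all_order all_algebra.
From mathcomp Require Import all_classical all_reals all_analysis.

Set Implicit Arguments.
Unset Strict Implicit.
Unset Printing Implicit Defensive.

Import Order.TTheory GRing.Theory Num.Theory.
Import numFieldNormedType.Exports.

Local Open Scope classical_set_scope.
Local Open Scope ring_scope.

(* Points are required because [measurableType] extends [pointedType]; this is
   harmless, as a space carrying a probability measure is nonempty. *)
#[short(type="pmetricType")]
HB.structure Definition PointedMetric (K : numDomainType) :=
  {T of Metric K T & isPointed T}.

#[short(type="completeMetricType")]
HB.structure Definition CompleteMetric (K : numDomainType) :=
  {T of CompletePseudoMetric K T & PseudoMetric_isMetric K T}.

Notation borel T := (g_sigma_algebraType (@open T)).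

Section mm_spaces.
Context {R : realType}.
Local Open Scope ereal_scope.

Definition msupport (T : pmetricType R) (mu : probability (borel T) R) :
    set T :=
  [set x | forall U : set T, open U -> U x -> 0 < mu U].

(* The isometry f : supp mu -> supp nu is represented by a map of the ambient
   spaces whose values outside supp mu are irrelevant. *)
Definition mm_isomorphic (S T : pmetricType R)
    (mu : probability (borel S) R) (nu : probability (borel T) R) : Prop :=
  exists f : S -> T,
    [/\ forall x y, msupport mu x -> msupport mu y ->
          mdist (f x) (f y) = mdist x y,
        f @` msupport mu = msupport nu &
        forall A : set (borel T), measurable A ->
          nu A = mu (msupport mu `&` f @^-1` A)].

(* A set of isomorphism classes of mm-spaces is represented by a set of
   mm-spaces. *)
Record mm_space := MMSpace {
  mm_sort :> completeMetricType R ;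
  mm_separable : exists2 D : set mm_sort, countable D & dense D ;
  mm_measure : probability (borel mm_sort) R ;
  mm_full_support : msupport mm_measure = setT }.

Definition lip1_map (X Y : mm_space) (f : X -> Y) : Prop :=
  forall x y, (mdist (f x) (f y) <= mdist x y)%R.

Definition Lip1 (X : mm_space) : set (X -> R) :=
  [set f | forall x y, (`|f x - f y| <= mdist x y)%R].

(* f is Borel, being continuous, so that mu_X (f @^-1` A) is meaningful. *)
Definition mm_dominated (Y X : mm_space) : Prop :=
  exists2 f : X -> Y, lip1_map f &
    forall A : set (borel Y), measurable A ->
      mm_measure Y A = mm_measure X (f @^-1` A).

Definition unitI : set R := `[0%R, 1%R[%classic.

(* Functions on I = [0, 1) are represented by functions on R whose values
   outside I are irrelevant. *)
Definition parameter (X : mm_space) (phi : R -> X) : Prop :=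
  measurable_fun unitI (phi : R -> borel X) /\
  forall A : set (borel X), measurable A ->
    lebesgue_measure (unitI `&` phi @^-1` A) = mm_measure X A.

Definition box_dist (X Y : mm_space) : \bar R :=
  ereal_inf [set e%:E | e in [set e : R | (0 <= e)%R /\
    exists (phi : R -> X) (psi : R -> Y) (I0 : set R),
      [/\ parameter phi /\ parameter psi,
          measurable I0 /\ I0 `<=` unitI,
          (1 - e)%:E <= lebesgue_measure I0 &
          forall s t, I0 s -> I0 t ->
            (`|mdist (phi s) (phi t) - mdist (psi s) (psi t)| <= e)%R]]].

Definition me_dist (f g : R -> R) : \bar R :=
  ereal_inf [set e%:E | e in [set e : R | (0 <= e)%R /\
    lebesgue_measure (unitI `&` [set s | (e < `|f s - g s|)%R]) <= e%:E]].

(* +oo when exactly one of A, B is empty, or if no finite e is admissible. *)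
Definition hausdorff_dist (T : Type) (d : T -> T -> \bar R) (A B : set T) :
    \bar R :=
  ereal_inf [set e%:E | e in [set e : R | [/\ (0 < e)%R,
    forall a, A a -> exists2 b, B b & d a b < e%:E &
    forall b, B b -> exists2 a, A a & d a b < e%:E]]].

Definition pullback_Lip1 (X : mm_space) (phi : R -> X) : set (R -> R) :=
  [set f \o phi | f in @Lip1 X].

Definition dconc (X Y : mm_space) : \bar R :=
  ereal_inf [set r | exists (phi : R -> X) (psi : R -> Y),
    [/\ parameter phi, parameter psi &
        r = hausdorff_dist me_dist (pullback_Lip1 phi) (pullback_Lip1 psi)]].

Definition pyramid_of (X : mm_space) : set mm_space :=
  [set X' | mm_dominated X' X].

End mm_spaces.
Arguments mm_space R : clear implicits.

Section cube.
Context {R : realType}.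

(* The norm of 'rV[R]_N is the sup norm. *)
Definition cube (N : nat) (r : {nonneg R}) : Type :=
  {x : 'rV[R]_N | `|x| <= r%:num}.

Variables (N : nat) (r : {nonneg R}).

HB.instance Definition _ := Choice.on (cube N r).

Definition cube_dist (x y : cube N r) : R := `|val x - val y|.

Let cube_distxx x : cube_dist x x = 0.
Proof. by rewrite /cube_dist subrr normr0. Qed.

Let cube_dist_eq0 x y : cube_dist x y = 0 -> x = y.
Proof. by move=> /normr0_eq0/subr0_eq/val_inj. Qed.

Let cube_dist_sym x y : cube_dist x y = cube_dist y x.
Proof. exact: distrC. Qed.

Let cube_dist_triangle y x z : cube_dist x z <= cube_dist x y + cube_dist y z.
Proof. exact: ler_distD. Qed.

HB.instance Definition _ := @isMetric.Build R (cube N r) cube_dist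
  cube_distxx cube_dist_eq0 cube_dist_sym cube_dist_triangle.

Let cube0_subproof : `|0 : 'rV[R]_N| <= r%:num.
Proof. by rewrite normr0. Qed.

HB.instance Definition _ := isPointed.Build (cube N r)
  (exist _ (0 : 'rV[R]_N) cube0_subproof).

End cube.

Section rho.
Context {R : realType}.
Local Open Scope ereal_scope.

Definition cube_spaces (N : nat) (r : {nonneg R}) : set (mm_space R) :=
  [set X | exists mu : probability (borel (cube N r)) R,
    mm_isomorphic (mm_measure X) mu].

Definition rho_k (k : nat) (P P' : set (mm_space R)) : \bar R :=
  ((4 * k)%:R^-1)%:E *
  hausdorff_dist box_dist (P `&` cube_spaces k (NngNum (ler0n R k)))
                          (P' `&` cube_spaces k (NngNum (ler0n R k))).

(* Formally defined for arbitrary families of mm-spaces, not just pyramids. *)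
Definition rho (P P' : set (mm_space R)) : \bar R :=
  \sum_(1 <= k <oo) (((2 ^+ k)^-1)%:E * rho_k k P P').

End rho.

(* Main.v *)
Require Import Defs.
From HB Require Import structures.
From mathcomp Require Import all_boot all_order all_algebra.
From mathcomp Require Import all_classical all_reals all_analysis.
From mathcomp Require Import measurable_realfun lra.

Set Implicit Arguments.
Unset Strict Implicit.
Unset Printing Implicit Defensive.

Import Order.TTheory GRing.Theory Num.Theory.
Import numFieldNormedType.Exports.

Local Open Scope classical_set_scope.
Local Open Scope ring_scope.

(** Every summand satisfies rho_k <= d_conc: for parameters phi of X and psi of
    Y and any e admissible in the Hausdorff distance between the pulled back
    Lipschitz functions, rho_k (P_X, P_Y) <= e holds, and the weights 2^-k add up to 1.

    Let X' be dominated by X through F and isometric, through j, to a subset of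
    the cube of dimension and radius k. Its coordinates x |-> (j (F x))_i are k
    functions in Lip_1(X); each has an e-close partner g_i in Lip_1(Y) for the
    distance me. Clamping the g_i to [-k, k] keeps both properties, and
    together they form a 1-Lipschitz map G from Y to the cube. The image Y' of
    the mm-space Y under G belongs to P_Y and to X(k, k) ([mm_image_exists],
    [cube_space_isometry]). Transporting phi and psi to X' and Y', the two
    points of the cube with parameter s are at sup distance at most e except
    for s in k sets of measure at most e each. Hence the box distance of X' and
    Y' is at most max(k e, 2 e), and so at most 2 k e ([box_dist_cube]),
    strictly less than 4 k e, the factor 4 k being exactly what the
    normalisation of rho_k removes ([pyramid_cube_approx], [rho_k_le]).

    The part that needs care is the construction of Y', because its carrier
    cannot be a set of points of the cube. The carriers of mm-spaces live in a
    universe strictly below the one in which families of mm-spaces are formed,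
    while real row vectors live in the larger one. The carrier of Y' is
    therefore a small set of codes, on which the metric of the cube is
    transported ([closure_code]). *)

(** * Borel maps and push-forwards *)

Section borel_maps.
Context {R : realType}.

(** The open sets generate the Borel sets. *)
Lemma measurable_fun_borel d (S : measurableType d) (T : ptopologicalType)
    (D : set S) (f : S -> borel T) :
  (forall U : set T, open U -> measurable (D `&` f @^-1` U)) ->
  measurable_fun D f.
Proof.
move=> mf; apply: (@measurability _ _ _ (borel T) D f (@open T)) => // _ [U oU <-].
exact: mf.
Qed.

Lemma continuous_measurable_borel (S T : ptopologicalType) (f : S -> T) :
  continuous f -> measurable_fun setT (f : borel S -> borel T).
Proof.
move=> /continuousP cf; apply: measurable_fun_borel => U oU.
by rewrite setTI; apply: sub_sigma_algebra; exact: cf.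
Qed.

Lemma continuous_measurable_borel_real (S : ptopologicalType) (f : S -> R) :
  continuous f -> measurable_fun setT (f : borel S -> R).
Proof.
move=> /continuousP cf.
apply: (measurability _ (RGenOInfty.measurableE R)) => _ [_ [x ->] <-].
by rewrite setTI; apply: sub_sigma_algebra; apply: cf; exact: rray_open.
Qed.

Lemma pushforward_probability d1 d2 (T1 : measurableType d1)
    (T2 : measurableType d2) (P : probability T1 R) (f : T1 -> T2) :
  measurable_fun setT f ->
  exists Q : probability T2 R, forall A, Q A = P (f @^-1` A).
Proof.
by move=> mf; exists (distribution P (mfun_Sub (mem_set mf))).
Qed.

End borel_maps.

(** * Nonexpanding maps *)

Section nonexpanding.
Context {R : realType}.

Definition nonexpanding (S T : metricType R) (f : S -> T) :=
  forall x y, mdist (f x) (f y) <= mdist x y.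

Lemma nonexpanding_continuous (S T : metricType R) (f : S -> T) :
  nonexpanding f -> continuous f.
Proof.
move=> f1 x; apply/metricType_numDomainType.cvgrPdist_lt => e e0.
apply/metricType_numDomainType.nbhs_mdistP; exists e => //= y.
by apply: le_lt_trans; exact: f1.
Qed.

Lemma Lip1_continuous (X : mm_space R) (f : X -> R) : Lip1 f -> continuous f.
Proof.
move=> f1; apply: (@nonexpanding_continuous X R^o) => x y.
by rewrite /mdist/= distrC; exact: f1.
Qed.

End nonexpanding.

(** * Completeness of closed subsets of a cube *)

Section completeness.
Context {R : realType}.

(** The image under j of a Cauchy filter converges to some j x, the range being
    closed, and the filter converges to x because j reflects balls. *)
Lemma closed_embedding_complete (T : pmetricType R)
    (M : completePseudoMetricType R) (j : T -> M) :
  (forall x y e, ball (j x) e (j y) <-> ball x e y) -> closed (range j) ->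
  forall F : set_system T, ProperFilter F -> cauchy F -> cvg F.
Proof.
move=> jball jclosed F FF Fcauchy.
have jFcauchy : cauchy (j @ F).
  apply/cauchy_ballP => e e0; rewrite near_map2.
  move/cauchy_ballP : Fcauchy => /(_ _ e0).
  by apply: filterS => -[x y] /= /jball.
have /cvg_ex[l jFl] : cvg (j @ F) by exact: cauchy_cvg.
have [x _ jxl] : range j l.
  by apply: (closed_cvg _ jclosed _ _ jFl); apply: nearW => y; exists y.
apply: (@cvgP _ F x); apply/fcvg_ballP => e e0.
move: jFl; rewrite -jxl => /cvg_ballP/(_ _ e0).
by apply: filterS => y /= /jball.
Qed.

End completeness.

Section cube_complete.
Context {R : realType} (N : nat) (r : {nonneg R}).

Lemma range_val_cube :
  range (val : cube N r -> 'rV[R]_N) = [set x | `|x| <= r%:num].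
Proof.
apply/seteqP; split=> [_ [x _ <-]|x xr]; first exact: (valP x).
by exists (exist _ x xr).
Qed.

Lemma cube_complete (F : set_system (cube N r)) :
  ProperFilter F -> cauchy F -> cvg F.
Proof.
move=> FF Fcauchy; pose j := (val : cube N r -> 'rV[R]_N).
apply: (@closed_embedding_complete R (cube N r) _ j) => // [x y e|].
  by rewrite mx_norm_ball ballEmdist.
rewrite /j range_val_cube.
apply: (@closed_comp _ _ (fun x : 'rV[R]_N => `|x|) [set x | x <= r%:num]).
  by move=> x _; exact: norm_continuous.
exact: closed_le.
Qed.

HB.instance Definition _ :=
  Uniform_isComplete.Build (cube N r) cube_complete.

End cube_complete.

(** * Small isometric copies of separable closed sets *)

Section closure_code.
Context {R : realType} (M : pmetricType R) (D : nat -> M).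

(** This is the Kuratowski embedding x |-> (n |-> d(D n, x)), in which each real
    number is replaced by its cut of rationals. Such codes form a type in Set,
    however large the universe of M is. *)
Definition dist_code (x : M) (n : nat) (q : rat) : bool :=
  mdist (D n) x < ratr q.

(** If x and y differ, some D n is closer to x than d(x, y) / 2, hence closer to x
    than to y, and a rational between these two distances separates the codes. *)
Lemma dist_code_inj (x y : M) :
  closure (range D) x -> dist_code x = dist_code y -> x = y.
Proof.
move=> Dx xy; apply: contrapT => /eqP; rewrite -(mdist_gt0 x y) => d_gt0.
have {}d_gt0 : 0 < mdist x y / 2 by rewrite divr_gt0.
have [_ [[n _ <-]]] := Dx _ (nbhsx_ballx x _ d_gt0).
rewrite ballEmdist/= metric_sym => nx.
have /rat_in_itvoo[q] : mdist (D n) x < mdist (D n) y.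
  have := metric_triangle x (D n) y; rewrite (metric_sym x (D n)); lra.
rewrite in_itv/= => /andP[xq qy].
have /(congr1 (fun c => c n q)) := xy.
by rewrite /dist_code xq ltNge (ltW qy).
Qed.

Definition closure_code : Set :=
  {c : nat -> rat -> bool | exists2 x, closure (range D) x & dist_code x = c}.

HB.instance Definition _ := gen_eqMixin closure_code.
HB.instance Definition _ := gen_choiceMixin closure_code.

Definition encode (x : M) (Dx : closure (range D) x) : closure_code :=
  exist _ (dist_code x) (ex_intro2 _ _ x Dx erefl).

Definition decode (c : closure_code) : M := s2val (cid2 (svalP c)).

Lemma closure_decode c : closure (range D) (decode c).
Proof. by rewrite /decode; case: cid2. Qed.

Lemma dist_code_decode c : dist_code (decode c) = sval c.
Proof. by rewrite /decode; case: cid2. Qed.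

Lemma encodeK x (Dx : closure (range D) x) : decode (encode Dx) = x.
Proof. by apply/esym/dist_code_inj; rewrite ?dist_code_decode. Qed.

Lemma decode_inj : injective decode.
Proof.
move=> c d cd; apply: eq_sig_hprop => [? ? ?|]; first exact: Prop_irrelevance.
by rewrite -!dist_code_decode cd.
Qed.

Lemma range_decode : range decode = closure (range D).
Proof.
apply/seteqP; split=> [_ [c _ <-]|x Dx]; first exact: closure_decode.
by exists (encode Dx) => //; exact: encodeK.
Qed.

Let dist (c d : closure_code) : R := mdist (decode c) (decode d).

Let distxx c : dist c c = 0.
Proof. exact: mdistxx. Qed.

Let dist_eq0 c d : dist c d = 0 -> c = d.
Proof. by move=> /mdist_positivity/decode_inj. Qed.

Let dist_sym c d : dist c d = dist d c.
Proof. exact: metric_sym. Qed.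

Let dist_triangle d c e : dist c e <= dist c d + dist d e.
Proof. exact: metric_triangle. Qed.

HB.instance Definition _ := @isMetric.Build R closure_code dist
  distxx dist_eq0 dist_sym dist_triangle.

HB.instance Definition _ := isPointed.Build closure_code
  (encode (subset_closure (imageT D 0))).

Lemma decode_isometry (c d : closure_code) :
  mdist (decode c) (decode d) = mdist c d.
Proof. by []. Qed.

Lemma closure_code_dense (c : closure_code) (U : set closure_code) :
  open U -> U c -> exists n, U (encode (subset_closure (imageT D n))).
Proof.
move=> oU Uc; have /nbhs_ballP[e /= e0 ceU] := open_nbhs_nbhs (conj oU Uc).
have [_ [[n _ <-] nce]] := closure_decode (nbhsx_ballx (decode c) _ e0).
exists n; apply: ceU; move: nce.
by rewrite !ballEmdist/= -decode_isometry encodeK.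
Qed.

End closure_code.

Section cube_closure_code.
Context {R : realType} (N : nat) (r : {nonneg R}) (D : nat -> cube N r).

Let closure_code_complete (F : set_system (closure_code D)) :
  ProperFilter F -> cauchy F -> cvg F.
Proof.
move=> FF Fcauchy; pose j := @decode R (cube N r) D.
apply: (@closed_embedding_complete R (closure_code D) _ j) => //.
by rewrite /j range_decode; exact: closed_closure.
Qed.

HB.instance Definition _ :=
  Uniform_isComplete.Build (closure_code D) closure_code_complete.

End cube_closure_code.

(** * The image of an mm-space in a cube *)

Lemma dense_sequence (R : realType) (X : mm_space R) :
  exists d : nat -> X, dense (range d).
Proof.
have [A /countable_injP[i i_inj] dA] := mm_separable X.
(* i enumerates A injectively; [point] fills the indices that i misses. *)
exists (fun n => xget point [set x | A x /\ i x = n]) => U U0 oU.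
have [x [Ux Ax]] := dA U U0 oU; exists x; split=> //; exists (i x) => //.
have /= [Ay iyx] := xgetPex point (ex_intro
  [set y | A y /\ i y = i x] x (conj Ax erefl)).
by apply: i_inj; rewrite ?inE.
Qed.

(** Y is the closure of the range of f with the push-forward measure. The closure
    is the support of that measure because X is its own support: an open set
    that meets the range pulls back to a nonempty open set. The closure is
    encoded along the image under f of a dense sequence of X. *)
Lemma mm_image_exists (R : realType) (X : mm_space R) (N : nat)
    (r : {nonneg R}) (f : X -> cube N r) : nonexpanding f ->
  exists (Y : mm_space R) (g : X -> Y) (j : Y -> cube N r),
    [/\ lip1_map g,
        forall A : set (borel Y), measurable A ->
          mm_measure Y A = mm_measure X (g @^-1` A),
        forall x, j (g x) = f x,
        forall y z, mdist (j y) (j z) = mdist y z &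
        closed (range j)].
Proof.
move=> f1; have fc := nonexpanding_continuous f1.
have [d dd] := dense_sequence X; pose D := f \o d.
have Df x : closure (range D) (f x).
  move=> U /fc; rewrite nbhsE => -[V [oV Vx] VU].
  have [_ [/[swap] -[n _ <-] Vdn]] := dd V (ex_intro _ x Vx) oV.
  by exists (D n); split; [exists n|exact: VU].
pose g x := encode (Df x).
have gK x : decode (g x) = f x by exact: encodeK.
have g1 : nonexpanding g by move=> x y; rewrite -decode_isometry !gK.
have gc := nonexpanding_continuous g1.
have g_dense (c : closure_code D) (U : set (closure_code D)) :
    open U -> U c -> exists n, U (g (d n)).
  move=> oU /(closure_code_dense oU)[n Un]; exists n.
  by congr U: Un; apply: decode_inj; rewrite gK encodeK.
have [mu muE] := pushforward_probability (mm_measure X)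
  (continuous_measurable_borel gc).
have sep : exists2 A : set (closure_code D), countable A & dense A.
  exists (range (g \o d)); first exact: card_image_le.
  move=> U [c Uc] oU; have [n Un] := g_dense _ _ oU Uc.
  by exists (g (d n)); split=> //; exists n.
have supp : msupport mu = setT.
  apply/seteqP; split=> // c _ U oU Uc; have [n Un] := g_dense _ _ oU Uc.
  rewrite muE; have : msupport (mm_measure X) (d n) by rewrite mm_full_support.
  by apply=> //; exact: (iffLR (continuousP _) gc _ oU).
exists (MMSpace sep supp), g, (@decode _ _ D); split=> //.
by rewrite range_decode; exact: closed_closure.
Qed.
(** * Coordinates in a cube *)

Section cube_coordinates.
Context {R : realType} (N : nat) (r : {nonneg R}).

Lemma rV_norm_le (x : 'rV[R]_N) (c : R) :
  0 <= c -> (forall i, `|x 0 i| <= c) -> `|x| <= c.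
Proof.
move=> c0 xc; rewrite [leLHS](mx_normrE x).
by apply: bigmax_le => // -[i j] _ /=; rewrite ord1.
Qed.

Lemma rV_coord_le (x : 'rV[R]_N) i : `|x 0 i| <= `|x|.
Proof.
rewrite [leRHS](mx_normrE x).
exact: (le_bigmax _ (fun ij : 'I_1 * 'I_N => `|x ij.1 ij.2|) (0, i)).
Qed.

Lemma Lip1_coord (X : mm_space R) (j : X -> cube N r) i :
  nonexpanding j -> Lip1 (fun x => val (j x) 0 i).
Proof.
move=> j1 x y; apply: le_trans (j1 x y).
by have := rV_coord_le (val (j x) - val (j y)) i; rewrite !mxE.
Qed.

(** The measure on the cube is the push-forward under j; its support is the range
    of j since that range is closed and X has full support. *)
Lemma cube_space_isometry (X : mm_space R) (j : X -> cube N r) :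
  (forall x y, mdist (j x) (j y) = mdist x y) -> closed (range j) ->
  cube_spaces N r X.
Proof.
move=> jiso jclosed.
have j1 : nonexpanding j by move=> x y; rewrite jiso.
have jc := nonexpanding_continuous j1.
have [mu muE] := pushforward_probability (mm_measure X)
  (continuous_measurable_borel jc).
exists mu; exists j; split.
- by move=> x y _ _; exact: jiso.
- rewrite mm_full_support; apply/seteqP; split=> [_ [x _ <-] U oU Ujx|y supp_y].
    rewrite muE; have : msupport (mm_measure X) x by rewrite mm_full_support.
    by apply=> //; exact: (iffLR (continuousP _) jc _ oU).
  apply: jclosed => U; rewrite nbhsE => -[V [oV Vy] VU].
  have := supp_y V oV Vy; rewrite muE.
  have [->|/set0P[x Vjx] _] := eqVneq (j @^-1` V) set0.
    by rewrite measure0 ltxx.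
  by exists (j x); split; [exists x|exact: VU].
- by move=> A _; rewrite mm_full_support setTI muE.
Qed.

End cube_coordinates.

(** * Parameters and the box distance *)

Section parameters.
Context {R : realType}.
Local Open Scope ereal_scope.

Lemma measurable_unitI : measurable (@unitI R).
Proof. exact: measurable_itv. Qed.

Lemma lebesgue_unitI : lebesgue_measure (@unitI R) = 1.
Proof. by rewrite /unitI lebesgue_measure_itv/= lte01 sube0. Qed.

Lemma parameter_comp (X Y : mm_space R) (f : X -> Y) (phi : R -> X) :
  lip1_map f ->
  (forall A : set (borel Y), measurable A ->
    mm_measure Y A = mm_measure X (f @^-1` A)) ->
  parameter phi -> parameter (f \o phi).
Proof.
move=> f1 fE [mphi phiE].
have mf := continuous_measurable_borel (nonexpanding_continuous f1).
split=> [|A mA].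
  exact: (@measurableT_comp _ _ _ _ (borel X) (borel Y) f _ phi).
rewrite comp_preimage phiE ?fE//.
by rewrite -[X in measurable X]setTI; exact: mf.
Qed.

Lemma measurable_Lip1_parameter (X : mm_space R) (f : X -> R) (phi : R -> X) :
  Lip1 f -> parameter phi -> measurable_fun unitI (f \o phi).
Proof.
move=> f1 [mphi _]; apply: (@measurableT_comp _ _ _ _ (borel X)) => //.
exact: continuous_measurable_borel_real (Lip1_continuous f1).
Qed.

Lemma measurable_deviation (f g : R -> R) (e : R) :
  measurable_fun unitI f -> measurable_fun unitI g ->
  measurable (unitI `&` [set s | (e < `|f s - g s|)%R]).
Proof.
move=> mf mg.
have mfg : measurable_fun unitI (fun s => `|f s - g s|)%R.
  by apply: measurableT_comp => //; exact: measurable_funB.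
have := mfg measurable_unitI `]e, +oo[%classic (measurable_itv _).
by congr measurable; apply/seteqP; split=> s /=; rewrite in_itv/= andbT.
Qed.

(** The infimum defining me_dist is approached by some d < e, and the set where
    the deviation exceeds e is contained in the one where it exceeds d. *)
Lemma me_dist_lt (f g : R -> R) (e : R) :
  measurable_fun unitI f -> measurable_fun unitI g -> me_dist f g < e%:E ->
  lebesgue_measure (unitI `&` [set s | (e < `|f s - g s|)%R]) <= e%:E.
Proof.
move=> mf mg /ereal_inf_lt[_ [d [d0 dfg] <-]]; rewrite lte_fin => de.
apply: (@le_trans _ _ d%:E); last by rewrite lee_fin ltW.
apply: le_trans dfg; apply: le_measure; rewrite ?inE.
- exact: measurable_deviation.
- exact: measurable_deviation.
- by move=> s [Is /= es]; split=> //=; exact: lt_trans es.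
Qed.

Lemma box_dist_le (X Y : mm_space R) (phi : R -> X) (psi : R -> Y) (B : set R)
    (e : R) :
  (0 <= e)%R -> parameter phi -> parameter psi ->
  measurable B -> B `<=` unitI -> lebesgue_measure B <= e%:E ->
  (forall s t, unitI s -> ~ B s -> unitI t -> ~ B t ->
    `|mdist (phi s) (phi t) - mdist (psi s) (psi t)| <= e)%R ->
  box_dist X Y <= e%:E.
Proof.
move=> e0 pphi ppsi mB BI Be dist_le; apply: ereal_inf_lbound.
exists e => //; split=> //; exists phi, psi, (unitI `\` B); split=> //.
- split; first by apply: measurableD => //; exact: measurable_unitI.
  by move=> s [].
- have -> : lebesgue_measure (unitI `\` B) = 1 - lebesgue_measure B.
    rewrite -lebesgue_unitI -[in RHS](setIidr BI).
    apply: measureD => //; first exact: measurable_unitI.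
    by apply: le_lt_trans (ltry 1%R); rewrite -lebesgue_unitI.
  by rewrite EFinB leeB.
- by move=> s t [Is nBs] [It nBt]; exact: dist_le.
Qed.

(** Outside the N exceptional sets, of total measure at most N e, all coordinates
    of j (phi s) and l (psi s) are e-close, so that these two points are e-close
    in the sup norm and the triangle inequality bounds the distortion by 2 e.
    The bound 2 N e covers both N e and 2 e as N is positive. *)
Lemma box_dist_cube (N : nat) (r : {nonneg R}) (X Y : mm_space R)
    (phi : R -> X) (psi : R -> Y) (j : X -> cube N r) (l : Y -> cube N r)
    (e : R) :
  (0 < N)%N -> (0 <= e)%R -> parameter phi -> parameter psi ->
  (forall x x', mdist (j x) (j x') = mdist x x') ->
  (forall y y', mdist (l y) (l y') = mdist y y') ->
  (forall i, lebesgue_measure (unitI `&`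
     [set s | (e < `|val (j (phi s)) ord0 i - val (l (psi s)) ord0 i|)%R])
     <= e%:E) ->
  box_dist X Y <= ((2 * N)%:R * e)%:E.
Proof.
(* A positive dimension makes [inord] available to index the sets by nat. *)
case: N j l => // N j l _ e0 pphi ppsi jiso liso jl.
have j1 : nonexpanding j by move=> x y; rewrite jiso.
have l1 : nonexpanding l by move=> x y; rewrite liso.
pose B n := unitI `&` [set s | (e < `|val (j (phi s)) ord0 (inord n)
                                    - val (l (psi s)) ord0 (inord n)|)%R].
have mB n : measurable (B n).
  by apply: measurable_deviation;
    [exact: measurable_Lip1_parameter (Lip1_coord _ j1) pphi
    |exact: measurable_Lip1_parameter (Lip1_coord _ l1) ppsi].
have e2N : (N.+1%:R * e <= (2 * N.+1)%:R * e)%R.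
  by rewrite ler_wpM2r// ler_nat leq_pmull.
apply: (@box_dist_le _ _ phi psi (\big[setU/set0]_(n < N.+1) B n)) => //.
- by rewrite mulr_ge0.
- exact: bigsetU_measurable.
- by rewrite -bigcup_mkord => s [n _ []].
- apply: (le_trans (Boole_inequality _ _)); first by move=> n _; exact: mB.
  apply: (@le_trans _ _ (\sum_(n < N.+1) e%:E)).
    by apply: lee_sum => n _; exact: jl.
  by rewrite sumEFin lee_fin sumr_const card_ord -[X in (X <= _)%R]mulr_natl.
- have close s : unitI s -> ~ (\big[setU/set0]_(n < N.+1) B n) s ->
      (mdist (j (phi s)) (l (psi s)) <= e)%R.
    move=> Is; rewrite -bigcup_mkord => nBs; apply: rV_norm_le => // i.
    rewrite leNgt; apply/negP; rewrite !mxE => ei; apply: nBs.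
    by exists (nat_of_ord i); [exact: ltn_ord|split=> //=; rewrite inord_val].
  move=> s t Is nBs It nBt; rewrite -jiso -liso.
  have ds := close s Is nBs; have dt := close t It nBt.
  have e2 : (2 * e <= (2 * N.+1)%:R * e)%R.
    by rewrite ler_wpM2r// ler_nat leq_pmulr.
  apply: le_trans e2.
  have := metric_triangle (j (phi s)) (l (psi s)) (j (phi t)).
  have := metric_triangle (l (psi s)) (l (psi t)) (j (phi t)).
  have := metric_triangle (l (psi s)) (j (phi s)) (l (psi t)).
  have := metric_triangle (j (phi s)) (j (phi t)) (l (psi t)).
  rewrite (metric_sym (l (psi s)) (j (phi s))).
  rewrite (metric_sym (l (psi t)) (j (phi t))).
  by move=> h1 h2 h3 h4; rewrite ler_norml; apply/andP; split; lra.
Qed.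

End parameters.
(** * Truncation of real functions *)

Section clamp.
Context {R : realType}.

Definition clamp (r x : R) : R := Num.max (- r) (Num.min r x).

Lemma clamp_id (r x : R) : `|x| <= r -> clamp r x = x.
Proof. by rewrite ler_norml => /andP[rx xr]; rewrite /clamp min_r// max_r. Qed.

Lemma norm_clamp_le (r x : R) : 0 <= r -> `|clamp r x| <= r.
Proof.
move=> r0; rewrite ler_norml /clamp le_max lexx/= ge_max ge_min lexx/= andbT.
by rewrite (le_trans _ r0)// oppr_le0.
Qed.

Lemma clamp_contraction (r x y : R) : `|clamp r x - clamp r y| <= `|x - y|.
Proof.
rewrite /clamp; have xy := ler_norm (x - y); have yx := ler_norm (y - x).
rewrite distrC in yx; rewrite ler_norml; apply/andP.
by case: (leP r x) => ?; case: (leP r y) => ?; case: (leP (- r) r) => ?;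
  case: (leP (- r) x) => ?; case: (leP (- r) y) => ?; split; lra.
Qed.

End clamp.

(** * Symmetry and positivity of the distances *)

Section distances.
Context {R : realType}.
Local Open Scope ereal_scope.

Lemma me_distC (f g : R -> R) : me_dist f g = me_dist g f.
Proof.
congr ereal_inf; congr image; apply/funext => e /=.
by under [X in unitI `&` X]eq_set do rewrite distrC.
Qed.

Lemma box_distC (X Y : mm_space R) : box_dist X Y = box_dist Y X.
Proof.
suff le (X' Y' : mm_space R) : box_dist X' Y' <= box_dist Y' X'.
  by apply/eqP; rewrite eq_le !le.
apply: le_ereal_inf_tmp => _ [e [e0 [phi [psi [I0 [[pphi ppsi] mI0 I0e dI0]]]]] <-].
apply: ereal_inf_lbound; exists e => //; split=> //.
exists psi, phi, I0; split=> // s t I0s I0t.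
by rewrite distrC; exact: dI0.
Qed.

Lemma hausdorff_dist_ge0 (T : Type) (d : T -> T -> \bar R) (A B : set T) :
  0 <= hausdorff_dist d A B.
Proof. by apply: le_ereal_inf_tmp => _ [e [e0 _ _] <-]; rewrite lee_fin ltW. Qed.

End distances.

(** * Pyramids *)

Section pyramids.
Context {R : realType}.
Local Open Scope ereal_scope.

(** The one-sided estimate behind rho_k: the Y' approximating X' is the image of Y
    under the clamped partners of the coordinates of X'. *)
Lemma pyramid_cube_approx (X Y : mm_space R) (phi : R -> X) (psi : R -> Y)
    (N : nat) (r : {nonneg R}) (e : R) :
  (0 < N)%N -> (0 <= e)%R -> parameter phi -> parameter psi ->
  (forall f, pullback_Lip1 phi f ->
    exists2 g, pullback_Lip1 psi g & me_dist f g < e%:E) ->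
  forall X', (pyramid_of X `&` cube_spaces N r) X' ->
  exists2 Y', (pyramid_of Y `&` cube_spaces N r) Y' &
    box_dist X' Y' <= ((2 * N)%:R * e)%:E.
Proof.
move=> N0 e0 pphi ppsi approx X' [[F F1 FE] [mu [j [jiso _ _]]]].
have {}jiso x y : mdist (j x) (j y) = mdist x y.
  by apply: jiso; rewrite mm_full_support.
have jF1 : nonexpanding (j \o F) by move=> x y; rewrite jiso; exact: F1.
pose f i (x : X) := val (j (F x)) ord0 i.
have f1 i : Lip1 (f i) by exact: Lip1_coord.
have /choice[g gP] i : exists g : Y -> R,
    Lip1 g /\ me_dist (f i \o phi) (g \o psi) < e%:E.
  have [_ [g g1 <-] fg] := approx _ (ex_intro2 _ _ (f i) (f1 i) erefl).
  by exists g.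
pose Gval (y : Y) : 'rV[R]_N := (\row_i clamp r%:num (g i y))%R.
have Gr y : (`|Gval y| <= r%:num)%R.
  by apply: rV_norm_le => // i; rewrite mxE norm_clamp_le.
pose G (y : Y) : cube N r := exist _ (Gval y) (Gr y).
have G1 : nonexpanding G.
  move=> x y; apply: rV_norm_le => [|i]; first exact: mdist_ge0.
  rewrite !mxE; apply: le_trans (clamp_contraction _ _ _) _.
  exact: (gP i).1.
have [Y' [q [l [q1 qE lq liso lclosed]]]] := mm_image_exists G1.
exists Y'; first by split; [exists q|exact: cube_space_isometry liso lclosed].
have pF := parameter_comp F1 FE pphi; have pq := parameter_comp q1 qE ppsi.
apply: (box_dist_cube N0 e0 pF pq jiso liso) => i.
have mf := measurable_Lip1_parameter (f1 i) pphi.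
have mg := measurable_Lip1_parameter (gP i).1 ppsi.
apply: le_trans (me_dist_lt mf mg (gP i).2).
have l1 : nonexpanding l by move=> x y; rewrite liso.
have mF := measurable_Lip1_parameter (Lip1_coord i jF1) pphi.
have ml := measurable_Lip1_parameter (Lip1_coord i l1) pq.
apply: le_measure; rewrite ?inE; [exact: measurable_deviation mF ml|
  exact: measurable_deviation|].
move=> s [Is /= es]; split=> //=; apply: lt_le_trans es _.
(* The coordinates of X' lie in [-r, r], so clamping leaves them unchanged. *)
rewrite lq /= mxE -[X in (`|X - _| <= _)%R](@clamp_id _ r%:num).
  exact: clamp_contraction.
by apply: le_trans (rV_coord_le _ _) _; exact: (valP (j (F (phi s)))).
Qed.

Lemma rho_k_le (X Y : mm_space R) (phi : R -> X) (psi : R -> Y) (k : nat)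
    (e : R) :
  (0 < k)%N -> (0 < e)%R -> parameter phi -> parameter psi ->
  (forall f, pullback_Lip1 phi f ->
    exists2 g, pullback_Lip1 psi g & me_dist f g < e%:E) ->
  (forall g, pullback_Lip1 psi g ->
    exists2 f, pullback_Lip1 phi f & me_dist f g < e%:E) ->
  rho_k k (pyramid_of X) (pyramid_of Y) <= e%:E.
Proof.
move=> k0 e0 pphi ppsi XY YX.
have k4 : (0 < (4 * k)%:R :> R)%R by rewrite ltr0n muln_gt0.
have lt24 : ((2 * k)%:R * e)%:E < ((4 * k)%:R * e)%:E.
  by rewrite lte_fin ltr_pM2r// ltr_nat ltn_pmul2r.
rewrite /rho_k lee_pdivrMl//; apply: ereal_inf_lbound.
exists ((4 * k)%:R * e)%R => //; split; first exact: mulr_gt0.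
  move=> X' /(pyramid_cube_approx k0 (ltW e0) pphi ppsi XY)[Y' Y'P XY'].
  by exists Y' => //; exact: le_lt_trans lt24.
have {}YX g : pullback_Lip1 psi g ->
    exists2 f, pullback_Lip1 phi f & me_dist g f < e%:E.
  by move=> /YX[f fP fg]; exists f => //; rewrite me_distC.
move=> Y' /(pyramid_cube_approx k0 (ltW e0) ppsi pphi YX)[X' X'P YX'].
by exists X' => //; rewrite box_distC; exact: le_lt_trans lt24.
Qed.

(** The weights 2^-k, for k >= 1, add up to 1. *)
Lemma rho_le (P P' : set (mm_space R)) (e : R) :
  (0 <= e)%R -> (forall k, (0 < k)%N -> rho_k k P P' <= e%:E) ->
  rho P P' <= e%:E.
Proof.
move=> e0 Pe; rewrite /rho.
have term0 k : 0 <= ((2 ^+ k)^-1)%:E * rho_k k P P'.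
  apply: mule_ge0; first by rewrite lee_fin invr_ge0 exprn_ge0.
  by apply: mule_ge0; [rewrite lee_fin invr_ge0|exact: hausdorff_dist_ge0].
rewrite -nneseries_addn//; apply: le_trans (epsilon_trick0 xpredT e0).
apply: lee_nneseries => [k _ _|k _]; first exact: term0.
by rewrite addn1 natrX mulrC EFinM lee_wpmul2l ?Pe.
Qed.

End pyramids.

Theorem theorem1p2 (R : realType) (X Y : mm_space R) :
  (rho (pyramid_of X) (pyramid_of Y) <= dconc X Y)%E.
Proof.
apply: le_ereal_inf_tmp => _ [phi [psi [pphi ppsi ->]]].
apply: le_ereal_inf_tmp => _ [e [e0 XY YX] <-].
by apply: rho_le => [|k k0]; [exact: ltW|exact: rho_k_le XY YX].
Qed.
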